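(* Let $e\geq 2$ be an integer, $q$ a prime power, and let $\tilde{J}_q(2e+1,e)$ be the twisted Grassmann graph. Then $\mu(\tilde{J}_q(2e+1,e))\leq \dfrac{q^{2e}(q^{e+2}-q+1)-1}{q-1}$.
   Context: For a connected graph $\Gamma$ with distance function $d$, a resolving set is a set of vertices $S=\{v_1,\ldots,v_k\}$ such that for any two distinct vertices $u,v$ the vectors $(d(u,v_1),\ldots,d(u,v_k))$ and $(d(v,v_1),\ldots,d(v,v_k))$ differ. The metric dimension $\mu(\Gamma)$ is the smallest size of a resolving set of $\Gamma$. The twisted Grassmann graph $\tilde{J}_q(2e+1,e)$ (van Dam–Koolen) is defined as follows: fix a $2e$-dimensional subspace $H$ of $\mathbb{F}_q^{2e+1}$; let $\mathcal{B}_1$ be the set of $(e+1)$-dimensional subspaces $W$ of $\mathbb{F}_q^{2e+1}$ with $W\not\subseteq H$, and $\mathcal{B}_2$ the set of $(e-1)$-dimensional subspaces $W$ of $\mathbb{F}_q^{2e+1}$ with $W\subseteq H$. The vertex set is $\mathcal{B}_1\cup\mathcal{B}_2$, and vertices $P,Q$ are adjacent iff $\dim P+\dim Q-2\dim(P\cap Q)=2$. *)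

(* Defs.v *)
From HB Require Import structures.
From mathcomp Require Import all_boot all_order all_algebra all_field.

Set Implicit Arguments.
Unset Strict Implicit.
Unset Printing Implicit Defensive.

Section MetricDimension.

Variables (T : finType) (adj : rel T).

(* The least n such that adj has a walk of length n from x to y. It is enough *)
(* to search below #|T|, which is also the value returned when x and y are    *)
(* not connected.                                                             *)
Definition gdist (x y : T) : nat :=
  find (fun n => [exists p : n.-tuple T, path adj x p && (last x p == y)])
       (iota 0 #|T|).

Definition resolving (S : {set T}) : bool :=
  [forall u, forall v, (u != v) ==>
     ([seq gdist u s | s in S] != [seq gdist v s | s in S])].

Definition metric_dim : nat :=
  #|[arg min_(S < [set: T] | resolving S) #|S| ]|.

Lemma gdist_min x y p :
  path adj x p -> last x p = y -> gdist x y <= size p.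
Proof.
move=> pp lp; have [le|lt] := leqP #|T| (size p).
  by apply: leq_trans le; rewrite -[leqRHS](size_iota 0) find_size.
rewrite leqNgt; apply/negP => /(before_find 0); rewrite nth_iota // add0n.
by move/existsP; apply; exists (in_tuple p); rewrite pp lp eqxx.
Qed.

Lemma gdist_walk x y : connect adj x y ->
  exists2 p, path adj x p & last x p = y /\ size p = gdist x y.
Proof.
case/connectP => p /shortenP[p' pp' up' _] ->{p}.
have lt : size p' < #|T|.
  by have := max_card (mem (x :: p')); rewrite (card_uniqP up').
have: has (fun n => [exists p : n.-tuple T, path adj x p && (last x p == last x p')])
  (iota 0 #|T|).
  apply/hasP; exists (size p'); first by rewrite mem_iota.
  by apply/existsP; exists (in_tuple p'); rewrite pp' eqxx.
move=> h; have := nth_find 0 h; rewrite -/(gdist _ _).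
rewrite nth_iota; last by move: h; rewrite has_find size_iota.
rewrite add0n => /existsP[p /andP[pp /eqP lp]].
by exists p => //; rewrite size_tuple.
Qed.

Lemma gdist_eq0 x y : (gdist x y == 0) = (x == y).
Proof.
apply/eqP/eqP => [h|->]; last first.
  by apply/eqP; rewrite -leqn0; apply: (@gdist_min y y [::]).
have T0 : 0 < #|T| by apply/card_gt0P; exists x.
have hs : has (fun n => [exists p : n.-tuple T, path adj x p && (last x p == y)])
  (iota 0 #|T|) by rewrite has_find size_iota -/(gdist _ _) h.
have := nth_find 0 hs; rewrite -/(gdist _ _) h nth_iota // => /existsP[p].
by rewrite (tuple0 p) /= => /eqP.
Qed.

Lemma resolvingT : resolving [set: T].
Proof.
apply/forallP => u; apply/forallP => v; apply/implyP; apply: contraNneq => h.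
have /eq_in_map/(_ u) := h; rewrite mem_enum inE => /(_ isT) /eqP.
by rewrite (eqP (_ : gdist u u == 0)) ?gdist_eq0 // eq_sym gdist_eq0 eq_sym.
Qed.

Lemma metric_dim_le S : resolving S -> metric_dim <= #|S|.
Proof.
by rewrite /metric_dim; case: arg_minnP => [|S0 _ h /h]; first exact: resolvingT.
Qed.

Lemma metric_dim_attained : exists2 S, resolving S & #|S| = metric_dim.
Proof.
rewrite /metric_dim; case: arg_minnP => [|S hS _]; first exact: resolvingT.
by exists S.
Qed.

End MetricDimension.

Section FiniteVspace.

(* The subType structure of {vspace vT} over square matrices is internal. *)
Import VectorInternalTheory.

Variables (F : finFieldType) (vT : vectType F).

HB.instance Definition _ := [Countable of {vspace vT} by <:].
HB.instance Definition _ := [Finite of {vspace vT} by <:].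

End FiniteVspace.

Section TwistedGrassmann.

Variables (F : finFieldType) (e : nat).
Notation V := 'rV[F]_(2 * e + 1).
Variable H : {vspace V}.

Definition tgrass_block1 : pred {vspace V} :=
  fun W => (\dim W == e + 1) && ~~ (W <= H)%VS.

Definition tgrass_block2 : pred {vspace V} :=
  fun W => (\dim W == e - 1) && (W <= H)%VS.

Definition tgrass_vertex : finType :=
  {W : {vspace V} | tgrass_block1 W || tgrass_block2 W}.

(* The truncated subtraction is exact: dim (P :&: Q) <= dim P, dim Q. *)
Definition tgrass_adj : rel tgrass_vertex := fun P Q =>
  \dim (val P) + \dim (val Q) - 2 * \dim (val P :&: val Q)%VS == 2.

End TwistedGrassmann.

(* Main.v *)
Require Import Defs.
From mathcomp Require Import all_boot all_order all_algebra all_field.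
From mathcomp Require Import zify ring.
Import Order.TTheory GRing.Theory Num.Theory.

(** Distances to a vertex S of the first block are given by dimensions of     *)
(** intersections, d(U, S) = (dim U + dim S) / 2 - dim (U :&: S). For every   *)
(** linear form w whose kernel M is not contained in H, choose an             *)
(** e-dimensional subspace X of M that is not contained in H, and take all    *)
(** (e+1)-dimensional S containing X: they are (q^(e+1) - 1) / (q - 1) in     *)
(** number, and there are q^(2e+1) forms. As dim (U :&: S) exceeds            *)
(** dim (U :&: X) exactly when S <= U + X, the distances to these S tell      *)
(** which of them lie in U + X. Hence they separate U from V if U <= M, V is  *)
(** not contained in M, and not both U <= X and V + X is everything; for      *)
(** distinct vertices such a form w exists for one of the orders (U, V) and   *)
(** (V, U). *)

(** The union of the pencils attached to linear forms is resolving and small enough. Distances: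
    [tgrass_path_lower] and the greedy moves of [tgrass_step] yield the exact formula [tgrass_gdist]
    for targets in the first block, so that comparing distances within one pencil compares
    dimensions of intersections. Separation: [axis_pencil_resolves] feeds [pencil_separates] into
    this formula, and [axis_pencils_separate] finds, for each pair, a form vanishing on one vertex
    but not on the other. Size: [card_pencil], summed over all q^(2e+1) forms, gives at most
    q^(2e+1) (q^(e+1) - 1) / (q - 1), which is (q^(2e) - 1) / (q - 1) below the bound. *)

Set Implicit Arguments.
Unset Strict Implicit.
Unset Printing Implicit Defensive.

(** * Dimensions of sums and intersections *)

Section Subspaces.

Variables (K : fieldType) (vT : vectType K).
Implicit Types (U V W X : {vspace vT}) (x y : vT).

Lemma dim_addv_line U x : \dim (U + <[x]>) = \dim U + (x \notin U).
Proof.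
case: (boolP (x \in U)) => [xU|xU] /=.
  by rewrite addn0; congr (\dim _); apply/addv_idPl; rewrite -memvE.
have x0 : x != 0%R by apply: contraNneq xU => ->; apply: mem0v.
have /eqP := dimv_sum_cap U <[x]>%VS; rewrite dim_vline x0.
suff -> : (U :&: <[x]>)%VS = 0%VS by rewrite dimv0 addn0 => /eqP.
apply/eqP; rewrite -subv0; apply/subvP => z /memv_capP[zU /vlineP[k zE]].
have [k0|k0] := eqVneq k 0%R; first by rewrite zE k0 scale0r mem0v.
case/negP: xU; rewrite -(scalerK k0 x) -zE; exact: memvZ.
Qed.

Lemma addv_line_id U x : x \in (U + <[x]>)%VS.
Proof. by apply: (subvP (addvSr _ _)); apply: memv_line. Qed.

Lemma exists_subspace_between U V k :
    (U <= V)%VS -> \dim U <= k <= \dim V ->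
  exists2 W, \dim W = k & (U <= W <= V)%VS.
Proof.
move=> UV /andP[]; elim: k => [|k IH].
  by rewrite leqn0 => /eqP dU _; exists U => //; rewrite subvv.
rewrite leq_eqVlt => /orP[/eqP dU _|Uk kV].
  by exists U => //; rewrite subvv.
have [//|W dW /andP[UW WV]] := IH _ (ltnW kV).
have /subvPn[x xV xW] : ~~ (V <= W)%VS.
  by apply/negP => /dimvS; rewrite dW leqNgt kV.
exists (W + <[x]>)%VS; first by rewrite dim_addv_line xW dW addn1.
by rewrite (subv_trans UW (addvSl _ _)) subv_add WV -memvE.
Qed.

Lemma dim_cap_addv_line U X x :
  x \notin X -> \dim (U :&: (X + <[x]>)) = \dim (U :&: X) + (x \in U + X)%VS.
Proof.
move=> xX; have := dimv_sum_cap U (X + <[x]>)%VS; have := dimv_sum_cap U X.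
rewrite addvA !dim_addv_line xX; case: (x \in _) => /=; lia.
Qed.

(** The elementary move in the graph: replace U by W + <[x]>, where W is a hyperplane of U
    containing the part A to be kept. *)
Lemma exchange_line (U A : {vspace vT}) x :
    x \notin U -> (A <= U)%VS -> \dim A < \dim U ->
  exists U', [/\ \dim U' = \dim U, (A + <[x]> <= U')%VS,
    (U' <= U + <[x]>)%VS & \dim (U :&: U') = (\dim U).-1].
Proof.
move=> xU AU dAU.
have [|W dW /andP[AW WU]] := @exists_subspace_between A U (\dim U).-1 AU.
  by lia.
have xW : x \notin W by apply: contra xU; apply/subvP.
exists (W + <[x]>)%VS; split; rewrite ?addvS //.
  by rewrite dim_addv_line xW dW; lia.
by rewrite dim_cap_addv_line // (addv_idPl WU) (negbTE xU) (capv_idPr WU) dW addn0.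
Qed.

(** This is the triangle inequality for dim U + dim W - 2 dim (U :&: W), hence the lower bound on
    path lengths. *)
Lemma dim_cap_triangle U V W :
  \dim (U :&: V) + \dim (V :&: W) <= \dim V + \dim (U :&: W).
Proof.
rewrite -dimv_sum_cap; apply: leq_add; apply: dimvS.
  by rewrite subv_add capvSr capvSl.
by rewrite subv_cap (subv_trans (capvSl _ _) (capvSl _ _))
  (subv_trans (capvSr _ _) (capvSr _ _)).
Qed.

(* The subspaces X + <[x]> determine U + X, namely as the union of those that *)
(* meet U in a larger dimension than X does, unless U <= X or U + X is        *)
(* everything; one such pair tells U and V apart even up to a shift of the    *)
(* dimensions by constants depending on U and V.                              *)
Lemma pencil_separates X U V :
    ~~ (V <= U + X)%VS -> ~~ (U <= X)%VS || ~~ (fullv <= V + X)%VS ->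
  exists x y, [/\ x \notin X, y \notin X &
    \dim (U :&: (X + <[x]>)) + \dim (V :&: (X + <[y]>)) <
    \dim (U :&: (X + <[y]>)) + \dim (V :&: (X + <[x]>))].
Proof.
case/subvPn=> x xV xUX UV; exists x.
have xX : x \notin X by apply: contra xUX; apply/subvP/addvSr.
have xVX : x \in (V + X)%VS by apply: subvP xV; apply: addvSl.
case/orP: UV => [/subvPn[y yU yX]|/subvPn[y _ yVX]].
  exists y; split => //; rewrite !dim_cap_addv_line // (negbTE xUX) xVX.
  rewrite (subvP (addvSl U X) _ yU); case: (y \in _); lia.
exists y; have yX : y \notin X by apply: contra yVX; apply/subvP/addvSr.
split => //; rewrite !dim_cap_addv_line // (negbTE xUX) xVX (negbTE yVX).
case: (y \in _); lia.
Qed.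

End Subspaces.

(** * Linear forms and their kernels *)

Section LinearForms.

Variables (K : fieldType) (n : nat).

Definition formker (w : 'cV[K]_n) : {vspace 'rV[K]_n} :=
  lker (linfun (mulmxr w)).

Lemma mem_formker w (z : 'rV[K]_n) : (z \in formker w) = (z *m w == 0)%R.
Proof. by rewrite memv_ker lfunE. Qed.

Lemma dim_formker w : n.-1 <= \dim (formker w).
Proof.
pose f : 'Hom('rV[K]_n, 'rV[K]_1) := linfun (mulmxr w).
have := limg_ker_dim f fullv; rewrite capfv dimvf /dim /= mul1n.
have := dimvS (subvf (f @: fullv)%VS); rewrite dimvf /dim /= => im dimf.
suff: n.-1 <= \dim (lker f) by [].
lia.
Qed.

(** The endomorphism 1 - [projv U] kills exactly U, so one of its coordinates is a form vanishing on
    U and nonzero at y. *)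
Lemma exists_formker (U : {vspace 'rV[K]_n}) y :
  y \notin U -> exists2 w, (U <= formker w)%VS & y \notin formker w.
Proof.
move=> yU; pose g : 'End('rV[K]_n) := (\1%VF - projv U)%R.
have gE z : g z = (z - projv U z)%R by rewrite add_lfunE opp_lfunE id_lfunE.
have [i gi] : exists i, g y 0%R i != 0%R.
  apply/existsP; apply: contraNT yU; rewrite negb_exists => /forallP g0.
  suff /eqP : g y = 0%R by rewrite gE subr_eq0 => /eqP ->; apply: memv_proj.
  by apply/rowP => i; rewrite mxE; apply/eqP; have := g0 i; rewrite negbK.
have mE z : (z *m col i (lin1_mx g) = (g z 0 i)%:M)%R.
  by rewrite -mul_rV_lin1 colE mulmxA -colE; apply/matrixP => a b; rewrite !ord1 !mxE eqxx mulr1n.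
exists (col i (lin1_mx g)); last first.
  rewrite mem_formker mE; apply: contra gi => /eqP/matrixP/(_ 0%R 0%R).
  by rewrite !mxE eqxx mulr1n => ->.
apply/subvP => z zU; rewrite mem_formker mE gE projv_id // subrr mxE.
by apply/eqP/matrixP => a b; rewrite !mxE mul0rn.
Qed.

End LinearForms.

(** * Number of subspaces in a pencil *)

Section Counting.

Variables (F : finFieldType) (n : nat).
Implicit Types (X W : {vspace 'rV[F]_n}).

(* Double counting of the vectors outside X: each of them lies in exactly one *)
(* subspace of the pencil.                                                    *)
Lemma card_pencil X :
  #|[set W | (X <= W)%VS && (\dim W == (\dim X).+1)]| *
    (#|F| ^ (\dim X).+1 - #|F| ^ \dim X) <= #|F| ^ n - #|F| ^ \dim X.
Proof.
set L := [set W | _].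
have cardD W : (X <= W)%VS ->
    \sum_(v | (v \in W) && (v \notin X)) 1 = #|F| ^ \dim W - #|F| ^ \dim X.
  move=> XW; rewrite -!card_vspace sum1_card -(cardID (mem X) (mem W)).
  rewrite (_ : #|[predI W & X]| = #|X|) ?addKn; last first.
    by apply: eq_card => v; rewrite !inE andb_idl // => /(subvP XW).
  by apply: eq_card => v; rewrite !inE andbC.
have cardV : \sum_(v : 'rV[F]_n | v \notin X) 1 = #|F| ^ n - #|F| ^ \dim X.
  have := cardD fullv (subvf X); rewrite dimvf /dim /= mul1n => <-.
  by apply: eq_bigl => v; rewrite memvf.
rewrite -cardV -sum_nat_const.
rewrite (eq_bigr (fun W => \sum_(v | (v \in W) && (v \notin X)) 1)); last first.
  by move=> W; rewrite inE => /andP[XW /eqP dW]; rewrite cardD // dW.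
rewrite (exchange_big_dep (fun v => v \notin X)) /=; last by move=> W v _ /andP[].
apply: leq_sum => v vX; rewrite sum1_card; apply/card_le1_eqP => W W'.
suff uW Y : Y \in [pred W | (W \in L) && ((v \in W) && (v \notin X))] ->
    Y = (X + <[v]>)%VS by move=> /uW -> /uW ->.
rewrite !inE => /andP[/andP[XY /eqP dY] /andP[vY _]]; apply/esym/eqP.
by rewrite eqEdim subv_add XY -memvE vY dim_addv_line vX dY addn1 /=.
Qed.

End Counting.

(** * Distances to vertices of the first block *)

Section Distance.

Variables (F : finFieldType) (e : nat) (H : {vspace 'rV[F]_(2 * e + 1)}).
Hypotheses (e_gt0 : 0 < e) (dimH : \dim H = 2 * e).
Implicit Types (u v s : tgrass_vertex H).

Definition tgspace u : {vspace 'rV[F]_(2 * e + 1)} := val u.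

Lemma tgrass_adjE u v : tgrass_adj u v =
  (\dim (tgspace u) + \dim (tgspace v) - 2 * \dim (tgspace u :&: tgspace v) == 2).
Proof. by []. Qed.

Lemma tgrass_vertexP u :
  {\dim (tgspace u) = e + 1 /\ ~~ (tgspace u <= H)%VS} +
  {\dim (tgspace u) = e - 1 /\ (tgspace u <= H)%VS}.
Proof.
have := valP u; rewrite -/(tgspace u); case: (boolP (tgrass_block1 H (tgspace u))).
  by case/andP=> /eqP; left.
by move=> _ /andP[/eqP]; right.
Qed.

Lemma tgrass_path_lower u p s : path (@tgrass_adj F e H) u p -> last u p = s ->
  \dim (tgspace u) + \dim (tgspace s) <=
    2 * size p + 2 * \dim (tgspace u :&: tgspace s).
Proof.
elim: p u => [|a p IH] u; first by move=> _ /= ->; rewrite capvv; lia.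
have -> : size (a :: p) = (size p).+1 by [].
case/andP; rewrite tgrass_adjE => /eqP ua pp lp; have := IH a pp lp.
have := dim_cap_triangle (tgspace u) (tgspace a) (tgspace s); lia.
Qed.

(** Some neighbour u' of u lowers dim u + dim s - 2 dim (u :&: s) by at least 2: s itself if
    adjacent, otherwise an exchange bringing in a vector of s without leaving the block of u. *)
Lemma tgrass_step u s : tgrass_block1 H (tgspace s) -> u != s ->
  exists2 u' : tgrass_vertex H, tgrass_adj u u' &
    \dim (tgspace u') + 2 * \dim (tgspace u :&: tgspace s) + 2 <=
    \dim (tgspace u) + 2 * \dim (tgspace u' :&: tgspace s).
Proof.
case/andP=> /eqP ds sH us.
have [us_adj|us_nadj] := boolP (tgrass_adj u s).
  by exists s => //; move: us_adj; rewrite tgrass_adjE => /eqP; rewrite capvv; clear; lia.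
have capS : \dim (tgspace u :&: tgspace s) <= \dim (tgspace s) by rewrite dimvS ?capvSr.
have bigger U' x : x \in tgspace s -> x \notin tgspace u ->
    ((tgspace u :&: tgspace s) + <[x]> <= U')%VS -> \dim U' = \dim (tgspace u) ->
    \dim U' + 2 * \dim (tgspace u :&: tgspace s) + 2 <=
    \dim (tgspace u) + 2 * \dim (U' :&: tgspace s).
  move=> xs xu sU' ->.
  have : ((tgspace u :&: tgspace s) + <[x]> <= U' :&: tgspace s)%VS.
    by rewrite subv_cap sU' subv_add capvSr -memvE.
  by move/dimvS; rewrite dim_addv_line memv_cap (negbTE xu) /=; clear; lia.
have [[du uH]|[du uH]] := tgrass_vertexP u.
  have nsu : ~~ (tgspace s <= tgspace u)%VS.
    by apply: contra us => su; rewrite eq_sym -val_eqE eqEdim su du ds leqnn.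
  (* Keeping y holds U' outside H; there is room for it, as dim (u :&: s) < e for distinct
     nonadjacent vertices. *)
  have [y yu yH] := subvPn uH; have [x xs xu] := subvPn nsu.
  have dcap : \dim (tgspace u :&: tgspace s) < e.
    have : \dim (tgspace u :&: tgspace s) != e.
      by apply: contra us_nadj => /eqP d; rewrite tgrass_adjE du ds d; apply/eqP; clear; lia.
    have : \dim (tgspace u :&: tgspace s) != e + 1.
      apply: contra nsu => /eqP d; rewrite -(_ : (tgspace u :&: tgspace s)%VS = tgspace s) ?capvSl //.
      by apply/eqP; rewrite eqEdim capvSr d ds leqnn.
    by move: capS; rewrite ds; clear; lia.
  have [||U' [dU' AU' _ dcU']] :=
      @exchange_line _ _ (tgspace u) (tgspace u :&: tgspace s + <[y]>)%VS x xu.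
  - by rewrite subv_add capvSl -memvE.
  - by rewrite dim_addv_line du; move: dcap; case: (_ \notin _); clear; lia.
  have U'b : tgrass_block1 H U'.
    rewrite /tgrass_block1 dU' du eqxx; apply: contra yH => /subvP; apply.
    by apply: (subvP (subv_trans (addvSl _ _) AU')); apply: addv_line_id.
  have U'v : tgrass_block1 H U' || tgrass_block2 H U' by rewrite U'b.
  exists (Sub U' U'v); first by rewrite tgrass_adjE /tgspace /= dU' dcU' du; apply/eqP; clear; lia.
  by apply: (bigger U' x) => //; apply: subv_trans AU'; rewrite addvS ?addvSl.
have nus : ~~ (tgspace u <= tgspace s)%VS.
  apply: contra us_nadj => us'; rewrite tgrass_adjE (capv_idPl us') du ds; apply/eqP; move: e_gt0; clear; lia.
(* The new vector must lie in H; s :&: H has dimension at least e, more than u. *)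
have /subvPn[x] : ~~ (tgspace s :&: H <= tgspace u)%VS.
  apply/negP => /dimvS; rewrite du.
  have := dimv_sum_cap (tgspace s) H; rewrite ds dimH.
  by have := dimvS (subvf (tgspace s + H)%VS); rewrite dimvf /dim /=; move: e_gt0; clear; lia.
case/memv_capP=> xs xH xu.
have [||U' [dU' AU' U'S dcU']] :=
    @exchange_line _ _ (tgspace u) (tgspace u :&: tgspace s)%VS x xu.
- exact: capvSl.
- rewrite ltn_neqAle dimvS ?capvSl // andbT.
  apply: contra nus => /eqP d; rewrite -(_ : (tgspace u :&: tgspace s)%VS = tgspace u) ?capvSr //.
  by apply/eqP; rewrite eqEdim capvSl d leqnn.
have U'v : tgrass_block1 H U' || tgrass_block2 H U'.
  rewrite /tgrass_block2 dU' du eqxx (subv_trans U'S) ?orbT //.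
  by rewrite subv_add uH -memvE.
exists (Sub U' U'v); last exact: (bigger U' x).
rewrite tgrass_adjE /tgspace /= dU' dcU' -/(tgspace u).
have : 0 < \dim (tgspace u) by rewrite lt0n dimv_eq0; apply: contra nus => /eqP ->; apply: sub0v.
by move=> u_gt0; apply/eqP; move: u_gt0; clear; lia.
Qed.

Lemma tgrass_path_upper n u s : tgrass_block1 H (tgspace s) ->
    \dim (tgspace u) + \dim (tgspace s) <= 2 * n + 2 * \dim (tgspace u :&: tgspace s) ->
  exists p, [/\ path (@tgrass_adj F e H) u p, last u p = s & size p <= n].
Proof.
move=> sb; elim: n u => [|n IH] u dus; have [<-|us] := eqVneq u s;
  try by exists [::].
  (* For n = 0 and u distinct from s, a further step would make dim u' + dim s - 2 dim (u' :&: s)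
     negative. *)
  have := dimvS (capvSr (tgspace u) (tgspace s)); have := dimvS (capvSl (tgspace u) (tgspace s)).
  have [u' _] := tgrass_step sb us.
  have := dimvS (capvSr (tgspace u') (tgspace s)); have := dimvS (capvSl (tgspace u') (tgspace s)).
  move: dus; clear; lia.
have [u' uu' du'] := tgrass_step sb us.
have [|p [pp lp sp]] := IH u'; first by move: dus du'; clear; lia.
by exists (u' :: p); rewrite /= uu' pp.
Qed.

Lemma tgrass_gdist u s : tgrass_block1 H (tgspace s) ->
  2 * gdist (@tgrass_adj F e H) u s + 2 * \dim (tgspace u :&: tgspace s) =
    \dim (tgspace u) + \dim (tgspace s).
Proof.
move=> sb; pose n := (\dim (tgspace u) + \dim (tgspace s))./2 - \dim (tgspace u :&: tgspace s).
have nE : \dim (tgspace u) + \dim (tgspace s) = 2 * n + 2 * \dim (tgspace u :&: tgspace s).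
  have := dimvS (capvSr (tgspace u) (tgspace s)); have := dimvS (capvSl (tgspace u) (tgspace s)).
  case/andP: sb => /eqP ds _; rewrite /n ds.
  by have [[-> _]|[-> _]] := tgrass_vertexP u; move: e_gt0; clear; lia.
have [|p [pp lp sp]] := @tgrass_path_upper n u s sb; first by rewrite nE.
have := gdist_min pp lp.
have [|p' pp' [lp' sp']] := @gdist_walk _ (@tgrass_adj F e H) u s.
  by apply/connectP; exists p.
by have := tgrass_path_lower pp' lp'; rewrite sp'; move: sp nE; clear; lia.
Qed.

End Distance.

(** * The resolving set and its size *)

Section ResolvingSet.

Variables (F : finFieldType) (e : nat) (H : {vspace 'rV[F]_(2 * e + 1)}).
Hypotheses (e_gt1 : 1 < e) (dimH : \dim H = 2 * e).
Implicit Types (u v s : tgrass_vertex H) (w : 'cV[F]_(2 * e + 1)).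

(* The default 0 occurs only when formker w <= H, see axisP. *)
Definition axis w : {vspace 'rV[F]_(2 * e + 1)} :=
  odflt 0%VS [pick X | [&& \dim X == e, (X <= formker w)%VS & ~~ (X <= H)%VS]].

Lemma axisP w : ~~ (formker w <= H)%VS ->
  [/\ \dim (axis w) = e, (axis w <= formker w)%VS & ~~ (axis w <= H)%VS].
Proof.
rewrite /axis; case: pickP => [X /and3P[/eqP dX XM XH] _ //|none].
case/subvPn=> z zM zH; have dz : \dim <[z]>%VS <= 1 by rewrite dim_vline leq_b1.
have [||X dX /andP[zX XM]] := @exists_subspace_between _ _ <[z]>%VS (formker w) e.
- by rewrite -memvE.
- by have := dim_formker w; move: dz e_gt1; clear; lia.
case/and3P: (none X); split; rewrite ?dX //.
by apply: contra zH => /subvP; apply; rewrite memvE.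
Qed.

(** The dimension test empties the pencil when [axis w] is the default 0. *)
Definition axis_pencil w : {set tgrass_vertex H} :=
  [set s | [&& tgrass_block1 H (val s), \dim (axis w) == e & (axis w <= tgspace s)%VS]].

Definition axis_pencils : {set tgrass_vertex H} := \bigcup_w axis_pencil w.

Lemma card_axis_pencil w : #|axis_pencil w| * (#|F| - 1) <= #|F| ^ (e + 1) - 1.
Proof.
have F1 : 1 < #|F| := finNzRing_gt1 F.
have [dX|dX] := eqVneq (\dim (axis w)) e; last first.
  rewrite (_ : axis_pencil w = set0) ?cards0 //.
  by apply/setP => s; rewrite !inE (negbTE dX) andbF.
have := card_pencil (axis w); rewrite dX.
set L := [set W | _] => cL.
have le : #|axis_pencil w| <= #|L|.
  rewrite -(card_imset _ (@val_inj _ _ (tgrass_vertex H))); apply/subset_leq_card/subsetP.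
  move=> _ /imsetP[s sP ->]; move: sP; rewrite !inE => /and3P[/andP[ds _] _ ->].
  by rewrite (eqP ds) addn1 /=.
have qe : 0 < #|F| ^ e by rewrite expn_gt0 (ltnW F1).
rewrite -(leq_pmul2r qe); apply: (@leq_trans (#|L| * (#|F| ^ e.+1 - #|F| ^ e))).
  by rewrite -mulnA mulnBl mul1n -expnS leq_mul2r le orbT.
apply: leq_trans cL _; rewrite mulnBl mul1n -expnD leq_eqVlt; apply/orP; left.
by apply/eqP; congr (_ ^ _ - _); clear; lia.
Qed.

Lemma card_axis_pencils :
  #|axis_pencils| * (#|F| - 1) <= #|F| ^ (2 * e + 1) * (#|F| ^ (e + 1) - 1).
Proof.
have le : #|axis_pencils| <= \sum_w #|axis_pencil w|.
  rewrite /axis_pencils; elim/big_rec2: _ => [|w n A _ IH]; first by rewrite cards0.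
  by rewrite (leq_trans (leq_card_setU _ _)) // leq_add2l.
apply: leq_trans (leq_mul le (leqnn _)) _; rewrite big_distrl /=.
have <- : #|{: 'cV[F]_(2 * e + 1)}| = #|F| ^ (2 * e + 1) by rewrite card_mx muln1.
rewrite -sum_nat_const.
by apply: leq_sum => w _; apply: card_axis_pencil.
Qed.

Lemma axis_pencil_resolves w u v :
    (tgspace u <= formker w)%VS -> ~~ (tgspace v <= formker w)%VS ->
    ~~ (formker w <= H)%VS ->
    [\/ \dim (tgspace u) = e + 1, \dim (tgspace v) = e - 1 |
        \dim (tgspace u) = e - 1 /\ (tgspace u <= tgspace v)%VS] ->
  exists2 s, s \in axis_pencils &
    gdist (@tgrass_adj F e H) u s != gdist (@tgrass_adj F e H) v s.
Proof.
move=> uM vM MH cases; have [dX XM XH] := axisP MH.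
have [||x [y [xX yX]]] := @pencil_separates _ _ (axis w) (tgspace u) (tgspace v).
- by apply: contra vM => h; apply: subv_trans h _; rewrite subv_add uM XM.
(* Suppose U <= X and V + X is everything. Dimensions refute this at once in the first two cases. In
   the third, V :&: X contains U, so dim (V + X) <= e + 2 < 2e + 1, using e > 1. *)
- rewrite -negb_and; apply/negP => /andP[uX full].
  have := dimvS full; have := dimvS uX; rewrite dimvf /dim /= dX.
  have := dimv_sum_cap (tgspace v) (axis w); rewrite dX.
  case: cases => [->|->|[du uv]].
  - by clear; lia.
  - by move: e_gt1; clear; lia.
  have : \dim (tgspace u) <= \dim (tgspace v :&: axis w).
    by apply: dimvS; rewrite subv_cap uv.
  have [[-> _]|[-> _]] := tgrass_vertexP v; rewrite du; move: e_gt1; clear; lia.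
have vertex z : z \notin axis w -> exists s, [/\ tgrass_block1 H (val s),
    s \in axis_pencils & tgspace s = (axis w + <[z]>)%VS].
  move=> zX; have b1 : tgrass_block1 H (axis w + <[z]>)%VS.
    rewrite /tgrass_block1 dim_addv_line dX zX eqxx /=.
    by apply: contra XH; apply: subv_trans; apply: addvSl.
  have b : tgrass_block1 H (axis w + <[z]>)%VS || tgrass_block2 H (axis w + <[z]>)%VS.
    by rewrite b1.
  exists (Sub (axis w + <[z]>)%VS b); split=> //.
  by apply/bigcupP; exists w; rewrite // !inE /= b1 dX eqxx addvSl.
have [s [sb sS <-]] := vertex x xX; have [t [tb tS <-]] := vertex y yX => lt.
have dE z r := @tgrass_gdist _ _ _ (ltnW e_gt1) dimH z r.
move: (dE u s sb) (dE v s sb) (dE u t tb) (dE v t tb) => {dE}.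
set d := gdist _ => us vs ut vt.
(* If u and v agreed on both s and t, the constants dim u and dim v would cancel and contradict the
   strict inequality [lt]. *)
have /orP[ds|dt] : (d u s != d v s) || (d u t != d v t).
- rewrite -negb_and; apply/negP => /andP[/eqP es /eqP et].
  by move: lt us vs ut vt; rewrite es et; clear; lia.
- by exists s.
- by exists t.
Qed.

Lemma axis_pencils_separate u v : u != v ->
  exists2 s, s \in axis_pencils &
    gdist (@tgrass_adj F e H) u s != gdist (@tgrass_adj F e H) v s.
Proof.
wlog duv : u v / \dim (tgspace u) <= \dim (tgspace v) => [wl uv|uv].
  have vu : v != u by apply: contraNneq uv => ->.
  have [uv_le|/ltnW vu_le] := leqP (\dim (tgspace u)) (\dim (tgspace v)).
    exact: wl uv_le uv.
  have [s sS dvu] := wl v u vu_le vu; exists s; first exact: sS.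
  by apply: contra_neq dvu => /esym.
have nvu : ~~ (tgspace v <= tgspace u)%VS.
  apply: contra uv => vu; apply/eqP/val_inj/esym/eqP.
  by rewrite -[_ == _]/(tgspace v == tgspace u) eqEdim vu.
(* A kernel has dimension at least 2e, so inside H it would be H and contain y. *)
have MnH y w : y \in H -> y \notin formker w -> ~~ (formker w <= H)%VS.
  move=> yH; apply: contra => MH; suff /eqP -> : formker w == H by [].
  by rewrite eqEdim MH dimH; apply: leq_trans (dim_formker w); rewrite addn1.
have [[du uH]|[du uH]] := tgrass_vertexP u.
  have [y yv yu] := subvPn nvu; have [w uM yM] := exists_formker yu.
  apply: (@axis_pencil_resolves w) => //; last by constructor 1.
    by apply/subvPn; exists y.
  by apply: contra uH; apply: subv_trans.
have [[dv vH]|[dv vH]] := tgrass_vertexP v; last first.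
  have [y yv yu] := subvPn nvu; have [w uM yM] := exists_formker yu.
  apply: (@axis_pencil_resolves w) => //; last by constructor 2.
    by apply/subvPn; exists y.
  by apply: (MnH y) => //; apply: (subvP vH).
have [uv'|/subvPn[y yu yv]] := boolP (tgspace u <= tgspace v)%VS.
  have /subvPn[y /memv_capP[yv yH] yu] : ~~ (tgspace v :&: H <= tgspace u)%VS.
    apply/negP => /dimvS; rewrite du.
    have := dimv_sum_cap (tgspace v) H; rewrite dv dimH.
    have := dimvS (subvf (tgspace v + H)%VS); rewrite dimvf /dim /=.
    by move: e_gt1; clear; lia.
  have [w uM yM] := exists_formker yu.
  apply: (@axis_pencil_resolves w) => //; last by constructor 3.
    by apply/subvPn; exists y.
  exact: (MnH y).
(* Here the roles of u and v are swapped: the form vanishes on v, which is not inside H. *)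
have [w vM yM] := exists_formker yv.
have [|||s sS] := @axis_pencil_resolves w v u vM.
- by apply/subvPn; exists y.
- by apply: contra vH; apply: subv_trans.
- by constructor 1.
move=> dvu; exists s; first exact: sS.
by apply: contra_neq dvu => /esym.
Qed.

Lemma axis_pencils_resolving : resolving (@tgrass_adj F e H) axis_pencils.
Proof.
apply/forallP => u; apply/forallP => v; apply/implyP => /axis_pencils_separate[s sS].
apply: contra => /eqP/eq_in_map/(_ s) ->//; by rewrite mem_enum.
Qed.

End ResolvingSet.

Local Open Scope ring_scope.

Theorem theorem4p1 (F : finFieldType) (q e : nat)
    (H : {vspace 'rV[F]_(2 * e + 1)}) :
  #|F| = q -> (2 <= e)%N -> \dim H = (2 * e)%N ->
  (metric_dim (@tgrass_adj F e H))%:R <=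
    (q%:R ^+ (2 * e) * (q%:R ^+ (e + 2) - q%:R + 1) - 1) / (q%:R - 1) :> rat.
Proof.
move=> qE e_gt1 dimH; have q1 : (1 < q)%N by rewrite -qE finNzRing_gt1.
have q1' : 1 < q%:R :> rat by rewrite ltr1n.
have le : (metric_dim (@tgrass_adj F e H) * (q - 1) <=
    q ^ (2 * e + 1) * (q ^ (e + 1) - 1))%N.
  rewrite -qE; apply: leq_trans (card_axis_pencils H); rewrite leq_mul2r.
  by rewrite metric_dim_le ?orbT // axis_pencils_resolving.
rewrite ler_pdivlMr ?subr_gt0 //.
have q0 : (0 < q)%N by rewrite ltnW.
move: le; rewrite -(ler_nat rat) !natrM !natrB ?expn_gt0 ?q0 //.
rewrite !natrX => /le_trans; apply.
have a1 : 1 <= q%:R ^+ (2 * e) :> rat by rewrite exprn_ege1 // ltW.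
(* The two numerators differ by exactly q^(2e) - 1. *)
rewrite -subr_ge0 (_ : _ - _ = q%:R ^+ (2 * e) - 1) ?subr_ge0 //.
by rewrite !exprD; ring.
Qed.
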